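(* Let $\lambda=2^{5/2}$. For every force $f=(f_0,0,0,\dots)$ with $f_0>0$, there exists a unique fixed point of the infinite system of ordinary differential equations $$\frac{d a_j}{dt}=\lambda^{j-1}a_{j-1}^2-\lambda^{j}a_ja_{j+1}+f_j\quad (j>0),\qquad \frac{d a_0}{dt}=-a_0a_1+f_0$$ (where $f_j=0$ for all $j\ge 1$), namely $$\{a_j\}=\big\{\lambda^{-\frac{j}{3}+\frac16}\sqrt{f_0}\big\},\qquad j\ge 0.$$
   Context: Sequences are real and indexed by $j=0,1,2,\dots$; $l^2$ is the space of real sequences with $\|a\|_{l^2}=\big(\sum_{j\ge 0}a_j^2\big)^{1/2}<\infty$. A solution of the system on $[0,T]$ (or on $[0,\infty)$ if $T=\infty$) is an $l^2$-valued function $a(t)=(a_0(t),a_1(t),\dots)$ such that each $a_j$ is $C^1$ on that interval and the equations hold on $(0,T)$ for all $j$. A fixed point is a time-independent solution, i.e. a sequence $\{a_j\}\in l^2$ for which the right-hand sides of all the equations vanish: $-a_0a_1+f_0=0$ and $\lambda^{j-1}a_{j-1}^2-\lambda^ja_ja_{j+1}+f_j=0$ for all $j\ge 1$.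
   Formalization: Uniqueness fails as stated, since the negative of a fixed point is also a fixed point; what is proved is that the fixed points in l^2 are exactly the given sequence and its negative, and that the given one is the unique nonnegative fixed point. *)

(* Defs.v *)
From HB Require Import structures.
From mathcomp Require Import all_boot all_order all_algebra.
From mathcomp Require Import all_classical all_reals all_analysis.
From mathcomp Require Import ring.

Set Implicit Arguments.
Unset Strict Implicit.
Unset Printing Implicit Defensive.

Import Order.TTheory GRing.Theory Num.Theory.

Local Open Scope ring_scope.

Definition lambda (R : realType) : R := 2 `^ (5 / 2).

Definition l2norm (R : realType) (a : nat -> R) : \bar R :=
  sqrte (\sum_(0 <= j <oo) (a j ^+ 2)%:E)%E.

Definition in_l2 (R : realType) (a : nat -> R) : Prop := (l2norm a < +oo)%E.

(* The equation of index j > 0 is the branch j = i.+1. *)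
Definition dyadic_rhs (R : realType) (f a : nat -> R) (j : nat) : R :=
  if j is i.+1 then
    lambda R ^+ i * a i ^+ 2 - lambda R ^+ i.+1 * a i.+1 * a i.+2 + f i.+1
  else - (a 0%N * a 1%N) + f 0%N.

Definition fixed_point (R : realType) (f a : nat -> R) : Prop :=
  in_l2 a /\ forall j, dyadic_rhs f a j = 0.

(* The right-hand sides are even in a, so fixed points come in pairs +a, -a:
   uniqueness can only hold up to a global sign, or among nonnegative
   sequences. *)
Lemma fixed_point_opp (R : realType) (f a : nat -> R) :
  fixed_point f a -> fixed_point f (fun j => - a j).
Proof.
move=> [al2 eqa]; split.
  by rewrite /in_l2 /l2norm (@eq_eseriesr _ _ (EFin \o (fun j => a j ^+ 2)))
    // => j _; rewrite sqrrN.
by move=> j; rewrite -(eqa j); case: j => [|j]; rewrite /dyadic_rhs; ring.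
Qed.

(* Main.v *)
Require Import Defs.
From HB Require Import structures.
From mathcomp Require Import all_boot all_order all_algebra.
From mathcomp Require Import all_classical all_reals all_analysis.
From mathcomp Require Import ring lra.

Import Order.TTheory GRing.Theory Num.Theory.
Local Open Scope ring_scope.

(** All entries of a fixed point have the same sign, and up to the symmetry
    [a |-> - a] they are positive.  The logarithm [x] of the ratio between a
    positive fixed point and the explicit one then satisfies
    [2 x_i = x_(i+1) + x_(i+2)] and [x_0 + x_1 = 0], hence
    [x_i = x_0 / 3 * (1 + 2 (-2)^i)].  If [x_0] were nonzero, [x] would grow
    exponentially along the even or the odd indices, whereas an [l^2] sequence
    is bounded, so that [x] grows at most linearly. *)

(** * Square-summable sequences *)

Lemma in_l2E (R : realType) (a : nat -> R) :
  in_l2 a <-> (\sum_(0 <= j <oo) (a j ^+ 2)%:E < +oo)%E.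
Proof.
rewrite /in_l2 /l2norm; set s := (\sum_(_ <= _ <oo) _)%E.
by case: s => [r| |] //=; rewrite !ltry.
Qed.

Lemma in_l2_bounded (R : realType) (a : nat -> R) :
  in_l2 a -> exists M : R, forall j, a j ^+ 2 <= M.
Proof.
move=> /in_l2E; set s := (\sum_(_ <= _ <oo) _)%E => s_fin.
have s_ge j : ((a j ^+ 2)%:E <= s)%E.
  have sq_ge0 n : (0 <= n)%N -> true -> (0%R <= (a n ^+ 2)%:E)%E.
    by move=> _ _; rewrite lee_fin sqr_ge0.
  (* The partial sum over indices below [j.+1] has [a j ^+ 2] as its last term. *)
  apply: le_trans (nneseries_lim_ge j.+1 sq_ge0).
  rewrite big_nat_recr //=; apply: leeDr; apply: sume_ge0 => n _; exact: sq_ge0.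
case: s s_fin s_ge => [r| |] // _ s_ge.
  by exists r => j; rewrite -lee_fin.
by have := s_ge 0%N; rewrite leNgt ltNyr.
Qed.

Lemma in_l2_geometric (R : realType) (c q : R) :
  0 < q < 1 -> in_l2 (fun j => c * q ^+ j).
Proof.
move=> /andP[q0 q1]; apply/in_l2E.
have sq_ge0 n : (0 <= n)%N -> true -> (0%R <= ((c * q ^+ n) ^+ 2)%:E)%E.
  by move=> _ _; rewrite lee_fin sqr_ge0.
(* The squares form a geometric series of first term [c ^+ 2] and ratio [q ^+ 2]; this is its
   sum. *)
apply: (@le_lt_trans _ _ (c ^+ 2 / (1 - q ^+ 2))%:E); last exact: ltry.
apply: lime_le; first exact: is_cvg_nneseries.
apply: nearW => n; rewrite sumEFin lee_fin.
have q2 : `|q ^+ 2| < 1.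
  by rewrite ger0_norm ?sqr_ge0 // expr_lt1 // ltW.
apply: le_trans (geometric_le_lim n (sqr_ge0 c) (exprn_gt0 2 q0) q2).
rewrite /series /= le_eqVlt; apply/orP; left; apply/eqP.
by apply: eq_bigr => i _; rewrite exprMn exprAC.
Qed.

(** * Exponential growth and the unstable recurrence *)

Lemma exp4_not_linearly_bounded (R : realType) (e C L : R) :
  0 < e -> ~ (forall k, e * 4 ^+ k <= C + k%:R * L).
Proof.
move=> e0 le_lin; pose M := Num.max `|C| `|L|.
have M0 : 0 <= M by rewrite le_max normr_ge0.
have CM : C <= M by rewrite le_max ler_norm.
have LM : L <= M by rewrite le_max (ler_norm L) orbT.
(* Since [4 ^+ k] is at least the square of [k.+1], the assumed bound gives [e * k.+1%:R <= M],
   which fails at this [k]. *)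
pose k := Num.truncn (M / e).
have k_gt : M < e * k.+1%:R by rewrite mulrC -ltr_pdivrMr // truncnS_gt.
have k2 : k.+1%:R <= 2 ^+ k :> R by rewrite -natrX ler_nat ltn_expl.
have: k.+1%:R * (e * k.+1%:R) <= k.+1%:R * M.
  apply: (@le_trans _ _ (e * 4 ^+ k)).
    rewrite mulrCA ler_wpM2l ?(ltW e0) //.
    have -> : 4 = 2 * 2 :> R by ring.
    by rewrite exprMn ler_pM.
  apply: le_trans (le_lin k) _.
  by rewrite -natr1 mulrDl mul1r addrC lerD // ler_wpM2l.
by rewrite ler_pM2l // leNgt k_gt.
Qed.

Lemma unstable_recurrence_eq0 (R : realType) (x : nat -> R) (C L : R) :
    x 0%N + x 1%N = 0 -> (forall i, 2 * x i = x i.+1 + x i.+2) ->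
    (forall i, x i <= C + i%:R * L) ->
  forall i, x i = 0.
Proof.
move=> x01 rec le_lin.
(* The recurrence conserves [x i.+1 + 2 * x i], which leaves a first-order recurrence with fixed
   point [x 0%N / 3] and multiplier -2. *)
have inv i : x i.+1 + 2 * x i = x 0%N.
  elim: i => [|i IH]; first by lra.
  by have := rec i; lra.
have sol i : x i - x 0%N / 3 = (2 * x 0%N / 3) * (-2) ^+ i.
  elim: i => [|i IH]; first by rewrite expr0; lra.
  by rewrite exprS mulrCA -IH; have := inv i; lra.
have sq2 : (-2) ^+ 2 = 4 :> R by ring.
have even k : x (2 * k)%N = x 0%N / 3 + (2 * x 0%N / 3) * 4 ^+ k.
  by have := sol (2 * k)%N; rewrite exprM sq2; lra.
have odd k : x (2 * k).+1 = x 0%N / 3 - (4 * x 0%N / 3) * 4 ^+ k.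
  by have := inv (2 * k)%N; rewrite even; lra.
have x0_eq0 : x 0%N = 0.
  (* An upper bound alone suffices because the powers of -2 alternate in sign: [x] tends to plus
     infinity along odd indices if [x 0%N < 0], along even ones if [x 0%N > 0]. *)
  have [x0_lt0|x0_gt0|//] := ltgtP (x 0%N) 0; exfalso.
  - apply: (@exp4_not_linearly_bounded _ (- (4 * x 0%N / 3))
      (C + L - x 0%N / 3) (2 * L)); first by lra.
    move=> k; have := le_lin (2 * k).+1.
    by rewrite odd -(natr1 (2 * k)) (natrM R 2 k); lra.
  - apply: (@exp4_not_linearly_bounded _ (2 * x 0%N / 3)
      (C - x 0%N / 3) (2 * L)); first by lra.
    by move=> k; have := le_lin (2 * k)%N; rewrite even (natrM R 2 k); lra.
by move=> i; have := sol i; rewrite x0_eq0; lra.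
Qed.

(** * Powers of [lambda] and the explicit fixed point *)

Lemma powR_gt1 (R : realType) (a r : R) : 1 < a -> 0 < r -> 1 < a `^ r.
Proof.
move=> a1 r0; have : 1 `^ r < a `^ r; last by rewrite powR1.
by rewrite gt0_ltr_powR // nnegrE // ltW // (lt_trans ltr01).
Qed.

Lemma lambda_gt1 (R : realType) : 1 < lambda R.
Proof. by apply: powR_gt1; lra. Qed.

Lemma lambda_gt0 (R : realType) : 0 < lambda R.
Proof. exact: lt_trans (lambda_gt1 R). Qed.

Lemma lambda_powRD (R : realType) (r s : R) :
  lambda R `^ (r + s) = lambda R `^ r * lambda R `^ s.
Proof. by rewrite powRD // (gt_eqF (lambda_gt0 R)) implybT. Qed.

Definition equilibrium {R : realType} (f0 : R) (j : nat) : R :=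
  lambda R `^ (- (j%:R / 3) + 1 / 6) * Num.sqrt f0.

Section Equilibrium.
Variables (R : realType) (f : nat -> R).
Hypotheses (f0_gt0 : 0 < f 0%N) (f_eq0 : forall j : nat, (0 < j)%N -> f j = 0).

Let A := equilibrium (f 0%N).
Let mu : R := lambda R `^ (- (1 / 3)).

Lemma equilibrium_gt0 j : 0 < A j.
Proof. by rewrite mulr_gt0 ?powR_gt0 ?lambda_gt0 // sqrtr_gt0. Qed.

Lemma equilibriumS j : A j.+1 = A j * mu.
Proof.
rewrite /A /equilibrium mulrAC -lambda_powRD; congr (_ `^ _ * _).
by rewrite -natr1; lra.
Qed.

Lemma equilibrium_geometric j : A j = A 0%N * mu ^+ j.
Proof.
elim: j => [|j IH]; first by rewrite expr0 mulr1.
by rewrite equilibriumS IH exprSr mulrA.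
Qed.

(** This relation is what makes a geometric sequence of ratio [mu] solve every equation of positive
    index. *)
Lemma lambda_mu : lambda R * mu ^+ 3 = 1.
Proof.
rewrite /mu -powR_mulrn ?powR_ge0 // -powRrM.
have -> : - (1 / 3) * 3%:R = -1 :> R by lra.
by rewrite powR_inv1 ?ltW ?lambda_gt0 // mulfV ?gt_eqF ?lambda_gt0.
Qed.

(** The exponent 1/6 is fixed here, by 1/6 + 1/6 - 1/3 = 0. *)
Lemma equilibrium0 : A 0%N ^+ 2 * mu = f 0%N.
Proof.
rewrite /A /equilibrium exprMn sqr_sqrtr ?ltW // expr2 [LHS]mulrAC.
rewrite /mu -!lambda_powRD.
have -> : - (0%:R / 3) + 1 / 6 + (- (0%:R / 3) + 1 / 6) + - (1 / 3) = 0 :> R.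
  by lra.
by rewrite powRr0 mul1r.
Qed.

Lemma equilibrium_fixed_point : fixed_point f A.
Proof.
split.
  have -> : A = (fun j => A 0%N * mu ^+ j).
    by apply/funext => j; exact: equilibrium_geometric.
  apply: in_l2_geometric; rewrite powR_gt0 ?lambda_gt0 //=.
  by rewrite /mu powRN invf_lt1 ?powR_gt1 ?powR_gt0 ?lambda_gt0 //;
    have := lambda_gt1 R; lra.
case=> [|i] /=.
  by rewrite equilibriumS -equilibrium0; ring.
rewrite f_eq0 // !equilibriumS addr0.
have -> : lambda R ^+ i.+1 * (A i * mu) * (A i * mu * mu) =
  lambda R ^+ i * A i ^+ 2 * (lambda R * mu ^+ 3) by rewrite exprS; ring.
by rewrite lambda_mu; ring.
Qed.

(** * Arbitrary fixed points *)

Section FixedPoint.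
Variable a : nat -> R.
Hypothesis fix_a : fixed_point f a.

Lemma fixed_point_eq0 : a 0%N * a 1%N = f 0%N.
Proof. by have := fix_a.2 0%N => /=; lra. Qed.

Lemma fixed_point_eqS i : a i ^+ 2 = lambda R * (a i.+1 * a i.+2).
Proof.
have li_neq0 : lambda R ^+ i != 0 by rewrite expf_neq0 // gt_eqF ?lambda_gt0.
apply: (mulfI li_neq0); have := fix_a.2 i.+1 => /=.
by rewrite f_eq0 // (exprS (lambda R)); lra.
Qed.

(** By induction: a positive product forces [a i != 0], so [a i ^+ 2], which is [lambda R] times the
    product two equations further on, is positive too. *)
Lemma fixed_point_same_sign i : 0 < a i * a i.+1.
Proof.
elim: i => [|i IH]; first by rewrite fixed_point_eq0.
have : a i != 0 by apply: contraTneq IH => ->; rewrite mul0r ltxx.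
rewrite -sqrf_eq0 eq_sym => a_sq; have := sqr_ge0 (a i).
by rewrite le_eqVlt (negPf a_sq) fixed_point_eqS pmulr_rgt0 // lambda_gt0.
Qed.

Lemma fixed_point_gt0 : 0 < a 0%N -> forall i, 0 < a i.
Proof.
move=> a0 i; elim: i => // i IH.
by have := fixed_point_same_sign i; rewrite pmulr_rgt0.
Qed.

Lemma pos_fixed_point_unique : 0 < a 0%N -> a = A.
Proof.
move=> /fixed_point_gt0 a_gt0.
have ln_M (x y : R) : 0 < x -> 0 < y -> ln (x * y) = ln x + ln y.
  by move=> x0 y0; rewrite lnM.
have lnA i : ln (A i.+1) = ln (A i) + ln mu.
  by rewrite equilibriumS ln_M ?equilibrium_gt0 // powR_gt0 // lambda_gt0.
have mu_gt0 : 0 < mu by rewrite powR_gt0 // lambda_gt0.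
have ln_lambda : ln (lambda R) + 3 * ln mu = 0.
  have := congr1 (@ln R) lambda_mu.
  by rewrite ln_M ?exprn_gt0 ?lambda_gt0 // lnXn // ln1 -(mulr_natl (ln mu) 3).
have lnf0 : 2 * ln (A 0%N) + ln mu = ln (f 0%N).
  rewrite -equilibrium0 ln_M ?exprn_gt0 ?equilibrium_gt0 //.
  by rewrite lnXn ?equilibrium_gt0 // -(mulr_natl (ln _) 2).
have [M a_le] := in_l2_bounded _ _ fix_a.1.
have eq0 : forall i, ln (a i) - ln (A i) = 0.
  (* The linear bound comes from [ln (a i) <= ln M / 2] and from [ln (A i)] being affine in [i] with
     slope [ln mu]. *)
  apply: (@unstable_recurrence_eq0 _ _
    (ln M / 2 - ln (A 0%N)) (- ln mu)).
  - have := congr1 (@ln R) fixed_point_eq0.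
    by rewrite ln_M // lnA; lra.
  (* The sequence [A] satisfies the same equation, as [ln (lambda R)] is [- 3 * ln mu]; subtracting
     cancels the constant term. *)
  - move=> i; have := congr1 (@ln R) (fixed_point_eqS i).
    rewrite lnXn // -(mulr_natl (ln _) 2)
      ln_M ?lambda_gt0 ?fixed_point_same_sign //.
    by rewrite ln_M //; have := lnA i; have := lnA i.+1; lra.
  - move=> i.
    have -> : ln (A i) = ln (A 0%N) + i%:R * ln mu.
      by elim: i => [|i IH]; [lra | rewrite lnA IH -natr1; lra].
    have a2_gt0 : 0 < a i ^+ 2 by rewrite exprn_gt0.
    have : ln (a i ^+ 2) <= ln M.
      by rewrite ler_ln ?posrE // (lt_le_trans a2_gt0).
    by rewrite lnXn // -(mulr_natl (ln _) 2); lra.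
apply/funext => i; apply: ln_inj; rewrite ?posrE ?equilibrium_gt0 //.
by apply/eqP; rewrite -subr_eq0 eq0.
Qed.

End FixedPoint.

Lemma fixed_pointP (a : nat -> R) :
  fixed_point f a <-> a = A \/ a = (fun j => - A j).
Proof.
split=> [fix_a | [->|->]]; last 2 first.
- exact: equilibrium_fixed_point.
- exact/fixed_point_opp/equilibrium_fixed_point.
(* A negative [a 0%N] reduces to the positive case by passing to the opposite sequence; zero
   contradicts [0 < a 0%N * a 1%N]. *)
have [a0_lt0|a0_gt0|a0_eq0] := ltgtP (a 0%N) 0.
- right; apply/funext => j.
  rewrite -(pos_fixed_point_unique _ (@fixed_point_opp _ _ _ fix_a)) ?opprK //.
  by rewrite oppr_gt0.
- by left; exact: pos_fixed_point_unique.
- by have := fixed_point_same_sign _ fix_a 0; rewrite a0_eq0 mul0r ltxx.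
Qed.

End Equilibrium.

Theorem theorem4p1 (R : realType) (f : nat -> R)
    (f0_gt0 : 0 < f 0%N) (f_eq0 : forall j : nat, (0 < j)%N -> f j = 0) :
  let A : nat -> R :=
    fun j => lambda R `^ (- (j%:R / 3) + 1 / 6) * Num.sqrt (f 0%N) in
  unique (fun a : nat -> R => fixed_point f a /\ forall j : nat, 0 <= a j) A /\
  (forall a : nat -> R,
    fixed_point f a <-> a = A \/ a = (fun j : nat => - A j)).
Proof.
move=> A; have A_gt0 : forall j, 0 < A j := equilibrium_gt0 _ _ f0_gt0.
have fixP := fixed_pointP _ _ f0_gt0 f_eq0.
split; last exact: fixP.
split=> [|a [/fixP [-> //|a_eq] a_ge0]].
  by split=> [|j]; [apply/fixP; left | exact: ltW].
by have := a_ge0 0%N; rewrite a_eq oppr_ge0 leNgt A_gt0.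
Qed.
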